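(* For every smooth Minkowski space $X$, $$s(X)\le v(X)\le 2\pi_1(X^\ast),$$ where $\pi_1(X^\ast)$ is the $1$-summing norm of the dual space $X^\ast$.
   Context: A Minkowski space is a finite-dimensional real Banach space $X$ with norm $\|\cdot\|$. Its dual $X^\ast$ is the space of linear functionals on $X$ with norm $\|x^\ast\|^\ast=\sup_{\|x\|\le 1}x^\ast(x)$. $X$ is smooth if $\lim_{t\to 0}\frac{\|x+th\|-\|x\|}{t}$ exists for all $x,h\in X$ with $x\ne 0$. For a Minkowski space $Y$, the $1$-summing norm (absolutely summing constant) is $$\pi_1(Y)=\inf\Bigl\{c>0:\ \text{for all } m \text{ and all } y_1,\dots,y_m\in Y,\ \sum_{i=1}^m\|y_i\|\le c\max_{\epsilon_i=\pm1}\Bigl\|\sum_{i=1}^m\epsilon_i y_i\Bigr\|\Bigr\}.$$ For a finite set $S\subseteq X$, a Steiner Minimal Tree (SMT) of $S$ is a finite tree $T$ whose vertex set $V(T)$ satisfies $S\subseteq V(T)\subseteq X$ and whose total length $\sum_{\{x,y\}\in E(T)}\|x-y\|$ is minimal among all finite trees with vertex set $V$ satisfying $S\subseteq V\subseteq X$. The elements of $S$ are called the vertices of the SMT, and the elements of $V(T)\setminus S$ its Steiner points. $v(X)$ denotes the largest degree (in $T$) of a vertex, i.e. an element of $S$, over all SMTs $T$ of finite sets $S$ in $X$; $s(X)$ denotes the largest degree of a Steiner point over all SMTs of finite sets in $X$. *)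

(* Defs.v *)
From HB Require Import structures.
From mathcomp Require Import all_boot all_order all_algebra.
From mathcomp Require Import finmap.
From mathcomp Require Import all_classical all_reals all_analysis.

Set Implicit Arguments.
Unset Strict Implicit.
Unset Printing Implicit Defensive.

Import Order.TTheory GRing.Theory Num.Theory.
Import numFieldNormedType.Exports.

Local Open Scope classical_set_scope.
Local Open Scope ring_scope.

(* Completeness is not required separately: it is automatic in finite
   dimension. *)
#[short(type="minkowskiType")]
HB.structure Definition Minkowski (R : realType) :=
  {X of NormedModule R X & Vector R X}.

Definition smooth (R : realType) (X : minkowskiType R) : Prop :=
  forall x h : X, x != 0 -> derivable (fun y : X => `|y| : R^o) x h.

Definition dual_space (R : realType) (X : minkowskiType R) := 'Hom(X, R^o).

(* The set is nonempty and, since X is finite-dimensional, bounded, so that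
   the real-valued supremum is the genuine one. *)
Definition dual_norm (R : realType) (X : minkowskiType R) (f : dual_space X) : R :=
  sup [set (f x : R) | x in [set x : X | `|x| <= 1]].

(* The norm is passed as a function so that the definition applies to the dual
   without building a normed-module instance on it. The default value 0 of the
   maximum is harmless because a norm is nonnegative. *)
Definition summing_const (R : realType) (Y : lmodType R) (nrm : Y -> R)
    (c : R) : Prop :=
  forall (m : nat) (y : 'I_m -> Y),
    \sum_(i < m) nrm (y i) <=
      c * \big[Num.max/0]_(eps : {ffun 'I_m -> bool})
             nrm (\sum_(i < m) (-1) ^+ eps i *: y i).

Definition pi1 (R : realType) (Y : lmodType R) (nrm : Y -> R) : R :=
  inf [set c : R | 0 < c /\ summing_const nrm c].

(* A simple graph on the finite type T is an adjacency relation. *)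
Definition is_tree (T : finType) (e : rel T) : Prop :=
  [/\ symmetric e /\ irreflexive e,
      (0 < #|T|)%N,
      forall x y : T, connect e x y
    & forall p : seq T, (2 < size p)%N -> ~ ucycle e p].

Definition degree (T : finType) (e : rel T) (x : T) : nat := #|[pred y | e x y]|.

(* Every edge is counted twice in the sum over ordered pairs. *)
Definition tree_length (R : realType) (X : minkowskiType R) (V : {fset X})
    (e : rel V) : R :=
  2^-1 * \sum_(p : V * V | e p.1 p.2) `|val p.1 - val p.2|.

Definition interconnecting_tree (R : realType) (X : minkowskiType R) (S V : {fset X})
    (e : rel V) : Prop :=
  (S `<=` V)%fset /\ is_tree e.

Definition is_SMT (R : realType) (X : minkowskiType R) (S V : {fset X})
    (e : rel V) : Prop :=
  interconnecting_tree S e /\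
  forall (V' : {fset X}) (e' : rel V'),
    interconnecting_tree S e' -> tree_length e <= tree_length e'.

(* Suprema of degrees in the extended reals: unboundedness would give +oo, and
   a finite supremum of a nonempty set of naturals is attained. *)
Definition vdeg (R : realType) (X : minkowskiType R) : \bar R :=
  ereal_sup [set d | exists (S V : {fset X}) (e : rel V) (x : V),
    [/\ is_SMT S e, val x \in S & d = ((degree e x)%:R)%:E]].

Definition sdeg (R : realType) (X : minkowskiType R) : \bar R :=
  ereal_sup [set d | exists (S V : {fset X}) (e : rel V) (x : V),
    [/\ is_SMT S e, val x \notin S & d = ((degree e x)%:R)%:E]].

(* Main.v *)
(* A tree that is an SMT of S and passes through a Steiner point x is also an
   SMT of S with x added, whence s(X) <= v(X).

   For the second bound, let x be a vertex of an SMT with neighbours v_i, and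
   let f_i be the derivative of the norm at x - v_i; smoothness makes it a
   linear functional, and f_i(x - v_i) = |x - v_i|.  Rerouting the edges x v_i with i
   in a set I through a new point x + t h does not shorten the tree, and letting
   t tend to 0 gives - \sum_(i in I) f_i(h) <= |h|.  Hence every signed sum of
   the f_i has dual norm at most 2, and the degree, which is at most the sum of
   the dual norms of the f_i, is at most 2c for every c admissible in the
   definition of pi_1.  That some c is admissible (otherwise the infimum would
   be the junk value 0) follows from the boundedness of coordinates in finite
   dimension. *)
Require Import Defs.
From HB Require Import structures.
From mathcomp Require Import all_boot all_order all_algebra.
From mathcomp Require Import finmap.
From mathcomp Require Import all_classical all_reals all_analysis.
From mathcomp Require Import lra ring.

Set Implicit Arguments.
Unset Strict Implicit.
Unset Printing Implicit Defensive.

Import Order.TTheory GRing.Theory Num.Theory.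
Import numFieldNormedType.Exports.

Local Open Scope classical_set_scope.
Local Open Scope ring_scope.

(** * Spanning trees of finite connected graphs *)

Definition remove_edge (T : finType) (e : rel T) (a b : T) : rel T :=
  [rel u v | [&& e u v, (u, v) != (a, b) & (u, v) != (b, a)]].

Lemma remove_edge_sym (T : finType) (e : rel T) (a b : T) :
  symmetric e -> symmetric (remove_edge e a b).
Proof.
move=> e_sym u v; rewrite /remove_edge /= e_sym !xpair_eqE.
by rewrite [(v == a) && _]andbC [(v == b) && _]andbC [X in _ && X]andbC.
Qed.

(** The rest of the cycle, from [b] through [c] and [q] back to [a], is a detour. It avoids the edge
    [a b] in both orientations because the vertices of the cycle are distinct. *)
Lemma connect_remove_cycle_edge (T : finType) (e : rel T) (a b c : T)
    (q : seq T) :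
  symmetric e -> ucycle e [:: a, b, c & q] ->
  forall u v, connect e u v -> connect (remove_edge e a b) u v.
Proof.
move=> e_sym /andP[/= /and3P[_ e_bc]].
rewrite rcons_path => /andP[e_cq e_qa].
rewrite !inE !negb_or -!andbA => /and5P[a_b a_c a_q b_c /andP[b_q _]].
pose e1 := remove_edge e a b.
have e1_sym : symmetric e1 by exact: remove_edge_sym.
have conn_ba : connect e1 b a.
  apply/connectP; exists (c :: rcons q a); last by rewrite /= last_rcons.
  rewrite /= rcons_path; apply/and3P; split.
  - rewrite /e1 /remove_edge /= e_bc !xpair_eqE ![c == _]eq_sym.
    by rewrite (negbTE a_c) (negbTE b_c) !andbF.
  - have : all (predC1 a) (c :: q).
      apply/allP => z /=; rewrite inE => /orP[/eqP->|zq]; first by rewrite eq_sym.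
      by apply: contraNneq a_q => <-.
    move=> q_a; apply: sub_in_path q_a e_cq => u v /= ua va e_uv.
    by rewrite /e1 /remove_edge /= e_uv !xpair_eqE (negbTE ua) (negbTE va) !andbF.
  (* The closing edge does end in [a], so it must be checked not to start at [b]; the third vertex
     [c] of the cycle ensures this. *)
  - have qb : last c q != b.
      have := mem_last c q; rewrite inE => /orP[/eqP->|]; first by rewrite eq_sym.
      by apply: contraTneq => ->.
    have qa : last c q != a.
      have := mem_last c q; rewrite inE => /orP[/eqP->|]; first by rewrite eq_sym.
      by apply: contraTneq => ->.
    by rewrite /e1 /remove_edge /= e_qa !xpair_eqE (negbTE qa) (negbTE qb).
move=> u v; apply: connect_sub => {}u {}v e_uv.
have [[-> ->]|uv_ab] := eqVneq (u, v) (a, b).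
  by rewrite (sym_connect_sym e1_sym).
have [[-> ->] //|uv_ba] := eqVneq (u, v) (b, a).
by apply: connect1; rewrite /e1 /remove_edge /= e_uv uv_ab.
Qed.

(** Induction on the number of adjacent ordered pairs: while a cycle exists, deleting one of its
    edges preserves connectedness. *)
Lemma spanning_tree (T : finType) (e : rel T) :
  symmetric e -> irreflexive e -> (0 < #|T|)%N -> (forall x y, connect e x y) ->
  exists2 e' : rel T, subrel e' e & is_tree e'.
Proof.
have [n] := ubnP #|[pred p : T * T | e p.1 p.2]|.
elim: n e => // n IHn e le_n e_sym e_irr T0 e_conn.
have [tree_e|/existsNP[p /not_implyP[p2 /contrapT p_cyc]]] :=
    pselect (forall p : seq T, (2 < size p)%N -> ~ ucycle e p).
  by exists e.
case: p p2 p_cyc => [|a [|b [|c q]]] // _ p_cyc.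
have [|||//|x y|e' e'e] := IHn (remove_edge e a b); last first.
- by exists e' => // x y /e'e /= /and3P[].
- exact: connect_remove_cycle_edge p_cyc x y (e_conn x y).
- by move=> u; rewrite /remove_edge /= e_irr.
- exact: remove_edge_sym.
apply: leq_trans (_ : _ < #|[pred p : T * T | e p.1 p.2]|)%N le_n.
apply/proper_card/properP; split; first by apply/fintype.subsetP => p /and3P[].
exists (a, b); rewrite !inE /=; first by case/andP: p_cyc => /andP[].
by rewrite /remove_edge /= eqxx andbF.
Qed.

(** * Competitors of a Steiner minimal tree *)

(* The competitor may be any connected graph whose vertices are mapped, not
   necessarily injectively, to points covering [S]. *)
Lemma SMT_le (R : realType) (X : minkowskiType R) (S V : {fset X}) (e : rel V)
    (T : finType) (e' : rel T) (pos : T -> X) :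
  is_SMT S e -> (0 < #|T|)%N -> symmetric e' ->
  (forall a b, connect e' a b) -> {in S, forall x, exists a, pos a = x} ->
  tree_length e <= 2^-1 * \sum_(p : T * T | e' p.1 p.2) `|pos p.1 - pos p.2|.
Proof.
move=> [_ e_min] T0 e'_sym e'_conn S_pos.
pose V' : {fset X} := [fset pos a | a in T]%fset.
have posV a : pos a \in V' by apply/imfsetP; exists a.
pose f a : V' := [` posV a]%fset.
(* The image graph with loops dropped; it is connected, and its spanning tree [h] is the genuine
   competitor. *)
pose g : rel V' := fun u v =>
  (u != v) && [exists p : T * T, [&& e' p.1 p.2, f p.1 == u & f p.2 == v]].
have fP (u : V') : exists a, u = f a.
  have /imfsetP[a _ ua] := fsvalP u; exists a; exact/val_inj.
have f_conn a b : connect e' a b -> connect g (f a) (f b).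
  move=> /connectP[p].
  elim: p a => [a _ ->//|c p IHp a /= /andP[e_ac c_p] /(IHp _ c_p)].
  apply: connect_trans; have [->//|ac] := eqVneq (f a) (f c).
  apply: connect1; rewrite /g ac; apply/existsP; exists (a, c).
  by rewrite /= e_ac !eqxx.
have [|||u v|h hg h_tree] := @spanning_tree _ g.
- move=> u v; rewrite /g eq_sym; congr (_ && _).
  by apply/existsP/existsP => -[[a b] /= /and3P[e_ab fa fb]]; exists (b, a);
    rewrite /= e'_sym e_ab fa fb.
- by move=> u; rewrite /g eqxx.
- by move/card_gt0P: T0 => [a _]; apply/card_gt0P; exists (f a).
- by have [[a ->] [b ->]] := (fP u, fP v); apply/f_conn/e'_conn.
have S_V' : (S `<=` V')%fset by apply/fsubsetP => x /S_pos[a <-].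
apply: (le_trans (e_min _ h (conj S_V' h_tree))).
rewrite ler_pM2l ?invr_gt0 ?ltr0n//.
(* Ordered pairs of [e'] are grouped by their images. Every edge of [h] has at least one preimage,
   and all other terms are nonnegative. *)
rewrite [leRHS](partition_big (fun p => (f p.1, f p.2)) predT)//=.
rewrite [leRHS](bigID (fun q : V' * V' => h q.1 q.2))/=.
rewrite -[leLHS]addr0 lerD//; last by do 2!apply: sumr_ge0 => ? _.
apply: ler_sum => -[u v] /hg /andP[_ /existsP[[a b] /= /and3P[e_ab /eqP fa /eqP fb]]].
rewrite (bigD1 (a, b)) /= ?e_ab ?fa ?fb ?eqxx// -fa -fb /= lerDl.
exact: sumr_ge0.
Qed.

(* The new point is [inl tt]. *)
Definition split_edges (V : finType) (e : rel V) (x : V) (I : pred V)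
    : rel (unit + V) := fun a b =>
  match a, b with
  | inl _, inl _ => false
  | inl _, inr v | inr v, inl _ => (v == x) || I v
  | inr u, inr v =>
    [&& e u v, ~~ ((u == x) && I v) & ~~ ((v == x) && I u)]
  end.

(* Minimality tested on the competitor in which the edges from [x] to the
   neighbours in [I] are rerouted through a new point [z]. *)
Lemma SMT_split (R : realType) (X : minkowskiType R) (S V : {fset X})
    (e : rel V) (x : V) (I : pred V) (z : X) :
  is_SMT S e -> (forall v, I v -> e x v) ->
  \sum_(v | I v) `|val x - val v| <=
    `|z - val x| + \sum_(v | I v) `|z - val v|.
Proof.
move=> e_SMT I_e; have [[S_V [[e_sym e_irr] _ e_conn _]] _] := e_SMT.
pose pos (a : unit + V) : X := if a is inr v then val v else z.
pose g := split_edges e x I.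
have g_sym : symmetric g.
  by move=> [[]|u] [[]|v] //=; rewrite /g/= e_sym; congr (_ && _); rewrite andbC.
(* A deleted edge from [x] to [v] is replaced by the path through the new point. *)
have conn_x v : I v -> connect g (inr x) (inr v).
  move=> Iv; apply: (@connect_trans _ _ (inl tt)); apply: connect1 => /=.
    by rewrite /g/= eqxx.
  by rewrite /g/= Iv orbT.
have conn_e u v : e u v -> connect g (inr u) (inr v).
  move=> e_uv; have [/andP[/eqP-> Iv]|n1] := boolP ((u == x) && I v).
    exact: conn_x.
  have [/andP[/eqP-> Iu]|n2] := boolP ((v == x) && I u).
    by rewrite (sym_connect_sym g_sym) conn_x.
  by apply: connect1; rewrite /g/= e_uv n1.
have connV u v : connect g (inr u) (inr v).
  have /connectP[p] := e_conn u v.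
  elim: p u => [u _ ->//|w p IHp u /= /andP[e_uw w_p] /(IHp _ w_p)].
  exact/connect_trans/conn_e.
have conn_z v : connect g (inl tt) (inr v).
  apply: connect_trans (connV x v); apply: connect1.
  by rewrite /g/= eqxx.
have Ix : I x = false by apply/negP => /I_e; rewrite e_irr.
have : tree_length e <=
    2^-1 * \sum_(p : (unit + V) * (unit + V) | g p.1 p.2) `|pos p.1 - pos p.2|.
  apply: (SMT_le e_SMT) => //.
  - by apply/card_gt0P; exists (inl tt).
  - by move=> [[]|u] [[]|v] //; rewrite (sym_connect_sym g_sym).
  - by move=> y /(fsubsetP S_V) yV; exists (inr [` yV]%fset).
rewrite /tree_length ler_pM2l ?invr_gt0 ?ltr0n//.
pose d (u v : V) := `|val u - val v|.
rewrite -(pair_big_dep xpredT e d).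
rewrite -(pair_big_dep xpredT g (fun a b => `|pos a - pos b|)) /=.
rewrite big_sumType /= (bigD1 tt) //= [X in _ + X + _]big1 ?addr0; last by case.
rewrite big_sumType.
under [X in _ <= _ + X]eq_bigr do rewrite big_sumType.
rewrite big_split /=.
rewrite [X in _ <= X + _ + _]big_pred0_eq add0r.
have zE : \sum_(v | (v == x) || I v) `|z - val v| =
    `|z - val x| + \sum_(v | I v) `|z - val v|.
  rewrite (bigD1 x) ?eqxx //=; congr (_ + _); apply: eq_bigl => v.
  by case: eqVneq => [->|_]; rewrite ?Ix ?andbT.
have -> : \sum_u \sum_(t : unit | (u == x) || I u) `|val u - z| =
    `|z - val x| + \sum_(v | I v) `|z - val v|.
  rewrite -zE [RHS]big_mkcond; apply: eq_bigr => u _.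
  rewrite big_mkcond (bigD1 tt) //= [X in _ + X]big1; last by case.
  by rewrite addr0 distrC.
(* [xE] and [xE'] collect the two orientations of the deleted edges; these are disjoint families
   because [I x] is false. *)
have xE : \sum_u \sum_v (if (u == x) && I v then d u v else 0) =
    \sum_(v | I v) d x v.
  rewrite (bigD1 x) //= eqxx [X in _ + X]big1 => [|u /negbTE->]; last exact: big1.
  by rewrite addr0 -big_mkcond.
have xE' : \sum_u \sum_v (if (v == x) && I u then d u v else 0) =
    \sum_(v | I v) d x v.
  rewrite exchange_big -xE; do 2!apply: eq_bigr => ? _.
  by rewrite /d distrC.
have -> : \sum_u \sum_(v | e u v) d u v =
    \sum_u \sum_(v | [&& e u v, ~~ ((u == x) && I v) & ~~ ((v == x) && I u)]) d u v
    + (\sum_(v | I v) d x v + \sum_(v | I v) d x v).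
  rewrite -{1}xE -xE' -!big_split; apply: eq_bigr => u _ /=.
  rewrite -!big_split big_mkcond [X in _ = X + _]big_mkcond -big_split.
  apply: eq_bigr => v _ /=.
  have [/andP[/eqP-> Iv]|_] := boolP ((u == x) && I v).
    by rewrite I_e // Ix andbF /= add0r addr0.
  have [/andP[/eqP-> Iu]|_] := boolP ((v == x) && I u).
    by rewrite e_sym I_e //= !add0r.
  by rewrite !andbT !addr0.
rewrite zE /d.
lra.
Qed.

(** * Linearity of the derivative of the norm *)

Definition norm_deriv (R : realType) (X : minkowskiType R) (x h : X) : R :=
  'D_h (fun y : X => `|y| : R^o) x.

Section NormDerivative.
Variables (R : realType) (X : minkowskiType R).
Hypothesis hX : smooth X.
Implicit Types x h k : X.

Lemma norm_deriv_near x h (eps : R) : x != 0 -> 0 < eps ->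
  \forall t \near (0 : R), `| `|x + t *: h| - `|x| - t * norm_deriv x h| <= eps * `|t|.
Proof.
move=> x0 eps0.
have /derivable_nbhs/eqaddoP /(_ eps eps0) := @hX x h x0.
apply: filterS => t /=.
rewrite opprD -![(_ + _ : _ -> _) _]/(_ + _) -![(- _ : _ -> _) _]/(- _) /=.
by rewrite addrA [t *: h + x]addrC.
Qed.

Lemma norm_deriv_small x h (eps : R) : x != 0 -> 0 < eps ->
  exists2 d : R, 0 < d & forall t, `|t| < d ->
    `| `|x + t *: h| - `|x| - t * norm_deriv x h| <= eps * `|t|.
Proof.
move=> x0 eps0; have /nbhs_normP[d d0 dP] := norm_deriv_near h x0 eps0.
by exists d => // t td; apply: dP => /=; rewrite sub0r normrN.
Qed.

(** At one small positive [t] the two first-order expansions, each taken with tolerance [eps / 2],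
    force the slopes within [eps]. The values of the derivative below are identified this way. *)
Lemma norm_deriv_unique x h (a : R) : x != 0 ->
  (forall eps : R, 0 < eps -> exists2 d : R, 0 < d & forall t, `|t| < d ->
     `| `|x + t *: h| - `|x| - t * a| <= eps * `|t|) ->
  norm_deriv x h = a.
Proof.
move=> x0 aP; apply/eqP; rewrite -subr_eq0 -normr_le0; apply/ler_addgt0Pl => e e0.
have [d d0 dP] := aP _ (divr_gt0 e0 (ltr0Sn _ 1)).
have [d' d'0 d'P] := norm_deriv_small h x0 (divr_gt0 e0 (ltr0Sn _ 1)).
pose t : R := Num.min d d' / 2.
have t0 : 0 < t by rewrite divr_gt0 // lt_min d0.
have tE : `|t| = t by rewrite gtr0_norm.
have [td td'] : `|t| < d /\ `|t| < d'.
  by rewrite tE /t; case: (leP d d') => ?; split; lra.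
rewrite addr0 -(@ler_pM2l R _ t0).
have -> : t * `|norm_deriv x h - a| = `|t * (norm_deriv x h - a)|.
  by rewrite normrM tE.
move: (dP t td) (d'P t td'); rewrite tE !ler_norml.
move=> /andP[? ?] /andP[? ?]; apply/andP; split; lra.
Qed.

Lemma norm_derivZ x h (c : R) : x != 0 ->
  norm_deriv x (c *: h) = c * norm_deriv x h.
Proof.
move=> x0; apply: norm_deriv_unique => // e e0.
(* Dividing by [|c| + 1] rather than [|c|] covers [c = 0] as well. *)
have c0 : 0 < `|c| + 1 by rewrite ltr_wpDl.
have [d d0 dP] := norm_deriv_small h x0 (divr_gt0 e0 c0).
exists (d / (`|c| + 1)) => [|t]; first exact: divr_gt0.
rewrite ltr_pdivlMr // => td; rewrite scalerA mulrA.
have /dP/le_trans : `|t * c| < d.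
  by apply: le_lt_trans td; rewrite normrM ler_wpM2l ?lerDl.
apply; rewrite normrM.
have -> : e / (`|c| + 1) * (`|t| * `|c|) = e * `|t| * (`|c| / (`|c| + 1)).
  by move: (_^-1) => i; ring.
by rewrite ler_piMr ?mulr_ge0 ?(ltW e0)// ler_pdivrMr // mul1r lerDl.
Qed.

(** Convexity of the norm: [x + t *: (h + k)] is the midpoint of [x + (2 * t) *: h] and
    [x + (2 * t) *: k]. *)
Lemma norm_derivD_le x h k : x != 0 ->
  norm_deriv x (h + k) <= norm_deriv x h + norm_deriv x k.
Proof.
move=> x0; apply/ler_addgt0Pl => e e0.
(* In the doubled inequality the errors are [2 * (e / 3) * t] on the left and [(e / 3) * (2 * t)]
   twice on the right, in total [2 * e * t]. *)
have e3 : 0 < e / 3 by rewrite divr_gt0.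
have [d1 d10 d1P] := norm_deriv_small (h + k) x0 e3.
have [d2 d20 d2P] := norm_deriv_small h x0 e3.
have [d3 d30 d3P] := norm_deriv_small k x0 e3.
pose t : R := Num.min d1 (Num.min d2 d3) / 4.
have t0 : 0 < t by rewrite divr_gt0 // !lt_min d10 d20.
have tE : `|t| = t by rewrite gtr0_norm.
have t2E : `|2 * t| = 2 * t by rewrite gtr0_norm // mulr_gt0.
have [td1 td2 td3] : [/\ `|t| < d1, `|2 * t| < d2 & `|2 * t| < d3].
  have : Num.min d1 (Num.min d2 d3) <= Num.min d1 (Num.min d2 d3) by [].
  rewrite le_min [X in _ && X]le_min.
  rewrite tE t2E /t; move: (Num.min _ _) => m /and3P[? ? ?]; split; lra.
have conv : 2 * `|x + t *: (h + k)| <= `|x + (2 * t) *: h| + `|x + (2 * t) *: k|.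
  rewrite -[X in X * _]ger0_norm // -normrZ; apply: le_trans (ler_normD _ _).
  rewrite scalerDr scaler_nat mulr2n scalerA [X in _ <= `|X|]addrACA.
  by rewrite scalerDr.
rewrite -(@ler_pM2l R _ t0).
move: (d1P _ td1) (d2P _ td2) (d3P _ td3); rewrite tE t2E !ler_norml.
move=> /andP[? ?] /andP[? ?] /andP[? ?]; lra.
Qed.

(* Subadditivity and oddness give additivity. *)
Lemma norm_derivD x h k : x != 0 ->
  norm_deriv x (h + k) = norm_deriv x h + norm_deriv x k.
Proof.
move=> x0; apply/le_anti; rewrite norm_derivD_le //= -lerBrDr.
have -> : h = (h + k) + (-1) *: k by rewrite scaleN1r addrK.
apply: le_trans (norm_derivD_le _ _ x0) _.
by rewrite norm_derivZ // mulN1r scaleN1r addrK.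
Qed.

Lemma norm_deriv_self x : x != 0 -> norm_deriv x x = `|x|.
Proof.
move=> x0; apply: norm_deriv_unique => // e e0; exists 1 => // t t1.
rewrite -[X in X + t *: _]scale1r -scalerDl normrZ ger0_norm; last first.
  by move: t1; rewrite ltr_norml => /andP[? ?]; lra.
have -> : (1 + t) * `|x| - `|x| - t * `|x| = 0 by ring.
by rewrite normr0 mulr_ge0 // ltW.
Qed.

End NormDerivative.

(** * The dual norm and finiteness of its summing constant *)

Section DualNorm.
Variables (R : realType) (X : minkowskiType R).

Let b := vbasis {:X}.

(** Equivalence of norms: the norm of [X], read in coordinates, is continuous and attains a minimum
    on the compact unit sphere of the sup norm. The minimum is positive since the basis is free, and
    its inverse is the constant. *)
Lemma coord_bounded : exists2 C : R, 0 <= C &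
  forall (x : X) i, `|coord b i x| <= C * `|x|.
Proof.
pose n := \dim {:X}.
pose f (a : 'rV[R]_n) : R := `|\sum_(i < n) a ord0 i *: b`_i|.
have f_cont : continuous f.
  move=> a; apply: (continuous_comp _ (@norm_continuous _ _ _)).
  apply: cvg_big => [||i _]; [exact: add_continuous|exact: nbhs_filter|].
  by apply: cvgZr_tmp; [exact: nbhs_filter|exact: coord_continuous].
have fE (x : X) : f (\row_i coord b i x) = `|x|.
  rewrite /f {2}(coord_vbasis (memvf x)); congr `|_|.
  by apply: eq_bigr => i _; rewrite mxE.
have fZ c (a : 'rV[R]_n) : f (c *: a) = `|c| * f a.
  rewrite /f -normrZ scaler_sumr; congr `|_|; apply: eq_bigr => i _.
  by rewrite mxE scalerA.
have coord_le (a : 'rV[R]_n) i : `|a ord0 i| <= `|a|.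
  have -> : `|a| = mx_norm a by [].
  by rewrite mx_normrE (le_bigmax _ (fun ij => `|a ij.1 ij.2|) (ord0, i)).
pose A := [set a : 'rV[R]_n | `|a| = 1].
have unitA a : a != 0 -> A (`|a|^-1 *: a).
  move=> a0; rewrite /A /= normrZ normrV ?unitfE ?normr_eq0//.
  by rewrite normr_id mulVf ?normr_eq0.
(* An empty sphere means that all coordinate vectors vanish, so the constant 0 works. *)
have [A0|/set0P/negP/negPn/eqP A0] := pselect (A !=set0); last first.
  exists 0 => // x i; rewrite mul0r normr_le0.
  have [a0|/unitA] := eqVneq (\row_i coord b i x) 0.
    by move/rowP: a0 => /(_ i); rewrite !mxE => ->.
  by rewrite A0.
have A_compact : compact A.
  apply: bounded_closed_compact.
    by exists 1; split => // M M1 a /= ->; exact: ltW.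
  apply: (@preimage_closed _ _ (fun a : 'rV[R]_n => `|a|) [set 1]).
    by move=> a _; exact: norm_continuous.
  exact: closed_eq.
have [c /set_mem Ac c_min] :=
  compact_EVT_min A0 A_compact (continuous_subspaceT f_cont).
have fc : 0 < f c.
  rewrite normr_gt0; apply/eqP => /(elimT freeP (basis_free (vbasisP {:X}))) c0.
  move: Ac; suff -> : c = 0 by rewrite /A /= normr0 => /esym/eqP; rewrite oner_eq0.
  by apply/rowP => i; rewrite c0 mxE.
exists (f c)^-1 => [|x i]; first by rewrite invr_ge0 ltW.
pose a := \row_i coord b i x.
have -> : coord b i x = a ord0 i by rewrite mxE.
apply: le_trans (coord_le _ _) _; rewrite ler_pdivlMl // -fE -/a.
have [->|a0] := eqVneq a 0; first by rewrite normr0 mulr0 /f.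
have := c_min _ (mem_set (unitA _ a0)).
by rewrite fZ normrV ?unitfE ?normr_eq0// normr_id ler_pdivlMl ?normr_gt0// mulrC.
Qed.

Lemma dual_expand (f : dual_space X) (x : X) :
  f x = \sum_(i < \dim {:X}) coord b i x * (f b`_i : R) :> R.
Proof.
rewrite {1}(coord_vbasis (memvf x)) linear_sum /=.
by apply: eq_bigr => i _; rewrite linearZ.
Qed.

Lemma dual_bounded : exists2 C : R, 0 <= C & forall (f : dual_space X) x,
  `|f x : R| <= C * (\sum_(i < \dim {:X}) `|f b`_i : R|) * `|x|.
Proof.
have [C C0 CP] := coord_bounded; exists C => // f x.
rewrite dual_expand (le_trans (ler_norm_sum _ _ _))// mulrAC mulr_sumr.
by apply: ler_sum => i _; rewrite normrM ler_wpM2r.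
Qed.

Lemma dual_norm_le (f : dual_space X) (c : R) :
  (forall x, `|x| <= 1 -> (f x : R) <= c) -> dual_norm f <= c.
Proof.
move=> fc; apply: ge_sup => [|_ [x x1 <-]]; last exact: fc.
by exists (f 0), 0; rewrite //= normr0.
Qed.

(** [dual_bounded] supplies the upper bound that makes the supremum genuine. *)
Lemma le_dual_norm (f : dual_space X) x : `|x| <= 1 -> (f x : R) <= dual_norm f.
Proof.
move=> x1; apply: ub_le_sup; last by exists x.
have [C C0 /(_ f) fP] := dual_bounded.
exists (C * (\sum_(i < \dim {:X}) `|f b`_i : R|)).
move=> _ [y y1 <-]; apply: le_trans (ler_norm _) _; apply: le_trans (fP y) _.
by rewrite ler_piMr // mulr_ge0 // sumr_ge0.
Qed.

Lemma dual_norm_ub (f : dual_space X) x : (f x : R) <= dual_norm f * `|x|.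
Proof.
have [->|x0] := eqVneq x 0; first by rewrite normr0 mulr0 linear0.
rewrite -ler_pdivrMr ?normr_gt0 // mulrC.
have -> : `|x|^-1 * (f x : R) = f (`|x|^-1 *: x) by rewrite linearZ.
apply: le_dual_norm.
by rewrite normrZ normrV ?unitfE ?normr_eq0// normr_id mulVf ?normr_eq0.
Qed.

(** At each basis vector a suitable choice of signs turns the sum of absolute values into the value
    of a single signed sum. Adding over the basis, [dual_bounded] controls the dual norms. *)
Lemma summing_const_dual : exists2 c : R, 0 < c & summing_const (@dual_norm R X) c.
Proof.
have [C C0 CP] := dual_bounded.
pose B := C * \sum_(i < \dim {:X}) `|b`_i|.
have B0 : 0 <= B by rewrite mulr_ge0 // sumr_ge0.
(* [B] is 0 in dimension 0, while an admissible constant must be positive. *)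
exists (B + 1) => [|m y]; first by rewrite ltr_wpDl.
set M := \big[Num.max/0]_ _ _.
have M0 : 0 <= M by exact: bigmax_ge_id.
have sign_le (j : 'I_(\dim {:X})) : \sum_(i < m) `|y i b`_j : R| <= M * `|b`_j|.
  pose eps : {ffun 'I_m -> bool} := [ffun i => (y i b`_j : R) < 0].
  pose f : dual_space X := \sum_(i < m) (-1) ^+ eps i *: y i.
  have -> : \sum_(i < m) `|y i b`_j : R| = f b`_j.
    rewrite /f sum_lfunE; apply: eq_bigr => i _; rewrite scale_lfunE ffunE.
    by rewrite /GRing.scale /= -normrEsign.
  apply: le_trans (dual_norm_ub _ _) _; rewrite ler_wpM2r //.
  exact: (le_bigmax _ (fun eps : {ffun 'I_m -> bool} =>
    dual_norm (\sum_(i < m) (-1) ^+ eps i *: y i)) eps).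
apply: (@le_trans _ _ (B * M)); last by rewrite mulrDl mul1r lerDl.
apply: (@le_trans _ _ (\sum_(i < m) C * \sum_(j < \dim {:X}) `|y i b`_j : R|)).
  apply: ler_sum => i _; apply: dual_norm_le => x x1.
  apply: le_trans (ler_norm _) _; apply: le_trans (CP _ _) _.
  by rewrite ler_piMr // mulr_ge0 // sumr_ge0.
rewrite -mulr_sumr -mulrA ler_wpM2l // exchange_big mulr_suml.
by apply: ler_sum => j _; rewrite mulrC.
Qed.

End DualNorm.

(** * The degree bound at a vertex *)

Section VertexDegree.
Variables (R : realType) (X : minkowskiType R).
Hypothesis hX : smooth X.

Lemma norming_functional (x : X) : x != 0 ->
  exists f : dual_space X, forall h, f h = norm_deriv x h.
Proof.
move=> x0.
have lin : linear (norm_deriv x : X -> R^o).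
  by move=> c h k; rewrite norm_derivD // norm_derivZ.
pose L := GRing.isLinear.Build _ _ _ _ _ lin.
pose g : {linear X -> R^o} := HB.pack (norm_deriv x : X -> R^o) L.
by exists (linfun g) => h; rewrite lfunE.
Qed.

Lemma norming_functional_norm (x : X) (f : dual_space X) : x != 0 ->
  (forall h, f h = norm_deriv x h) -> 1 <= dual_norm f.
Proof.
move=> x0 fE; have := dual_norm_ub f x.
by rewrite fE norm_deriv_self // ler_pMl // normr_gt0.
Qed.

(** First-order expansion of [SMT_split] at [z = x + t *: h], divided by [t]. *)
Lemma SMT_norm_deriv_sum (S V : {fset X}) (e : rel V) (x : V) (I : pred V) (h : X) :
  is_SMT S e -> (forall v, I v -> e x v) ->
  - \sum_(v | I v) norm_deriv (val x - val v) h <= `|h|.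
Proof.
move=> e_SMT I_e; have [[_ [[_ e_irr] _ _ _]] _] := e_SMT.
have w0 v : I v -> val x - val v != 0.
  by move=> /I_e; apply: contraTneq => /subr0_eq/val_inj->; rewrite e_irr.
apply/ler_addgt0Pl => eps eps0.
(* The error [eps] is shared among the at most [#|V|] terms; adding 1 makes [N] visibly positive. *)
pose N : R := #|{: V}|%:R + 1.
have N0 : 0 < N by rewrite ltr_wpDl.
pose close (v : V) (t : R) := I v ->
    `| `|val x - val v + t *: h| - `|val x - val v| - t * norm_deriv (val x - val v) h|
    <= eps / N * `|t|.
have : \forall t \near (0 : R), forall v, close v t.
  apply: (@filter_forall _ _ close (nbhs (0 : R))) => v.
  rewrite /close; have [Iv|nIv] := boolP (I v); last exact: nearW.
  by apply: filterS (norm_deriv_near hX h (w0 _ Iv) (divr_gt0 eps0 N0)).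
move=> /nbhs_normP[d /= d0 dP].
pose t : R := d / 2.
have t0 : 0 < t by rewrite divr_gt0.
have tE : `|t| = t by rewrite gtr0_norm.
have /dP /= tP : `|0 - t| < d by rewrite sub0r normrN tE /t; lra.
have := SMT_split (val x + t *: h) e_SMT I_e.
rewrite [_ + _ - _]addrAC subrr add0r normrZ tE => split_le.
rewrite -(@ler_pM2l R _ t0) mulrN mulr_sumr mulrDr.
have : \sum_(v | I v) `|val x + t *: h - val v| <=
    \sum_(v | I v) (`|val x - val v| + t * norm_deriv (val x - val v) h)
    + \sum_(v | I v) eps / N * t.
  rewrite -big_split; apply: ler_sum => v /tP; rewrite tE ler_norml => /andP[_].
  by rewrite [val x + _ - _]addrAC /=; lra.
have : \sum_(v | I v) eps / N * t <= t * eps.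
  rewrite sumr_const -mulr_natr; set k := _%:R.
  have kN : k <= N by rewrite (@le_trans _ _ #|{: V}|%:R) ?lerDl // ler_nat max_card.
  have -> : eps / N * t * k = t * eps * (k / N) by move: (N^-1) => i; ring.
  apply: ler_piMr; first by rewrite mulr_ge0 // ltW.
  by rewrite ler_pdivrMr // mul1r.
rewrite big_split /=; lra.
Qed.

Lemma SMT_degree_le (S V : {fset X}) (e : rel V) (x : V) (c : R) :
  is_SMT S e -> 0 < c -> summing_const (@dual_norm R X) c ->
  (degree e x)%:R <= c * 2.
Proof.
move=> e_SMT c0 cP; have [[_ [[_ e_irr] _ _ _]] _] := e_SMT.
pose N := [pred v | e x v].
pose w (i : 'I_#|N|) : X := val x - val (enum_val i).
have w0 i : w i != 0.
  apply/eqP => /subr0_eq/val_inj xE.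
  by have := enum_valP i; rewrite -xE inE e_irr.
have /choice[f fE] i := norming_functional (w0 i).
have := cP _ f; rewrite /degree -/N.
have one_le : #|N|%:R <= \sum_i dual_norm (f i).
  rewrite -[X in X%:R]card_ord -sumr_const; apply: ler_sum => i _.
  exact: norming_functional_norm (w0 i) (fE i).
move=> /(le_trans one_le)/le_trans; apply; rewrite ler_wpM2l ?(ltW c0)//.
apply: bigmax_le => // eps _; apply: dual_norm_le => h h1.
have part_le (P : pred 'I_#|N|) k : `|k| <= 1 ->
    - \sum_(i | P i) norm_deriv (w i) k <= 1.
  move=> k1; apply: le_trans k1.
  (* Transports a set of neighbour indices to a set of vertices. *)
  pose P' v := [exists i, (enum_val i == v) && P i].
  have P'E i : P' (enum_val i) = P i.
    apply/existsP/idP => [[j /andP[/eqP/enum_val_inj->]]//|Pi].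
    by exists i; rewrite eqxx.
  have := @SMT_norm_deriv_sum S V e x [pred v | (v \in N) && P' v] k e_SMT.
  have -> : \sum_(v | [pred v | (v \in N) && P' v] v)
      norm_deriv (val x - val v) k = \sum_(i | P i) norm_deriv (w i) k.
    rewrite [LHS]big_mkcondr big_enum_val [RHS]big_mkcond.
    by apply: eq_bigr => i _; rewrite P'E.
  by apply=> v /andP[].
(* The terms of sign -1 are bounded at [h], those of sign +1 at [- h]; each half contributes at most
   1. *)
rewrite sum_lfunE (bigID eps) /=.
have -> : \sum_(i | eps i) ((-1) ^+ eps i *: f i) h =
    - \sum_(i | eps i) norm_deriv (w i) h.
  rewrite -sumrN; apply: eq_bigr => i ei.
  by rewrite scale_lfunE ei expr1 fE scaleN1r.
have -> : \sum_(i | ~~ eps i) ((-1) ^+ eps i *: f i) h =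
    - \sum_(i | ~~ eps i) norm_deriv (w i) (- h).
  rewrite -sumrN; apply: eq_bigr => i /negbTE ei.
  by rewrite scale_lfunE ei expr0 scale1r fE -[- h]scaleN1r norm_derivZ // mulN1r opprK.
by apply: lerD; apply: part_le; rewrite ?normrN.
Qed.

End VertexDegree.

Theorem theorem5 (R : realType) (X : minkowskiType R) (hX : smooth X) :
  (sdeg X <= vdeg X)%E /\
  (vdeg X <= (2 * pi1 (@dual_norm R X))%:E)%E.
Proof.
split; apply: ge_ereal_sup => _ [S [V [e [x [e_SMT xS ->]]]]].
  (* Every tree interconnecting the enlarged set also interconnects [S], so minimality is
     inherited. *)
  apply: ereal_sup_ubound; exists (val x |` S)%fset, V, e, x.
  split => //; last by rewrite !inE eqxx.
  case: e_SMT => -[S_V e_tree] e_min.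
  split; first by split => //; rewrite fsubUset S_V fsub1set (valP x).
  move=> V' e' [xS_V' e'_tree]; apply: e_min; split => //.
  exact: fsubset_trans (fsubsetU1 _ _) xS_V'.
rewrite lee_fin -ler_pdivrMl ?ltr0n//; apply: lb_le_inf.
  by have [c c0 cP] := summing_const_dual X; exists c.
move=> c [c0 cP]; rewrite ler_pdivrMl ?ltr0n// mulrC.
exact: SMT_degree_le e_SMT c0 cP.
Qed.
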